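(* Let $A = \{a_1, a_2, \dots\}$ with $0 \le a_1 < a_2 < \cdots$ be an infinite sequence of nonnegative integers such that $a_n = n^3 + o(\log\log n)$ as $n \to \infty$. Then $s_A = \infty$.
   Context: For an infinite set $A = \{a_1 < a_2 < \cdots\}$ of nonnegative integers, $R_A(n)$ is the number of pairs $(i,j)$ with $i \le j$ and $a_i + a_j = n$; $s_A(x) = \max_{n \le x} R_A(n)$ and $s_A = \lim_{x\to\infty} s_A(x)$, which may be infinite. *)

(* Defs.v *)
From HB Require Import structures.
From mathcomp Require Import all_boot all_order all_algebra finmap.
From mathcomp Require Import all_classical all_reals all_analysis.
Set Implicit Arguments.
Unset Strict Implicit.
Unset Printing Implicit Defensive.
Import Order.TTheory GRing.Theory Num.Theory.
Import numFieldNormedType.Exports.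
Local Open Scope classical_set_scope.

(* A = {a_1 < a_2 < ...} is given by its increasing enumeration a : nat -> nat,
   indexed from 1; the value [a 0] is never used. *)
Definition strictly_incr (a : nat -> nat) : Prop :=
  forall n : nat, (1 <= n)%N -> (a n < a n.+1)%N.

Definition rep_pairs (a : nat -> nat) (n : nat) : set (nat * nat) :=
  [set p | (1 <= p.1 <= p.2)%N /\ (a p.1 + a p.2)%N = n].

(* [fset_set] sends infinite sets to the empty one; [finite_rep_pairs] below
   rules this case out for increasing a. *)
Definition rep_count (a : nat -> nat) (n : nat) : nat :=
  #|` fset_set (rep_pairs a n) |%fset.

Definition max_rep (a : nat -> nat) (x : nat) : nat :=
  \max_(n < x.+1) rep_count a n.

(* [max_rep a] is nondecreasing, so this limit always exists in [\bar R]. *)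
Definition sup_rep (R : realType) (a : nat -> nat) : \bar R :=
  limn (fun x : nat => ((max_rep a x)%:R)%:E).

Lemma strictly_incr_ge (a : nat -> nat) :
  strictly_incr a -> forall n, (n <= (a n).+1)%N.
Proof.
move=> ha; case=> // n; elim: n => // n IHn.
by rewrite ltnS (leq_ltn_trans _ (ha n.+1 _)).
Qed.

Lemma finite_rep_pairs (a : nat -> nat) (n : nat) :
  strictly_incr a -> finite_set (rep_pairs a n).
Proof.
move=> ha; apply: (@sub_finite_set _ _ (`I_n.+2 `*` `I_n.+2)).
  move=> [i j] [_ /= <-]; split=> /=; rewrite ltnS.
    by rewrite (leq_trans (strictly_incr_ge ha i))// ltnS leq_addr.
  by rewrite (leq_trans (strictly_incr_ge ha j))// ltnS leq_addl.
by apply: finite_setX; exact: finite_II.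
Qed.

Lemma is_cvg_max_rep (R : realType) (a : nat -> nat) :
  cvgn (fun x : nat => ((max_rep a x)%:R)%:E : \bar R).
Proof.
apply: ereal_nondecreasing_is_cvgn => x y xy.
rewrite lee_fin ler_nat; apply/bigmax_leqP => i _.
by apply: (@leq_bigmax _ (fun i : 'I_y.+1 => rep_count a i) (widen_ord (xy : (x < y.+1)%N) i)).
Qed.

(* Main.v *)
Require Import Defs.
From mathcomp Require Import all_boot all_order all_algebra.
From mathcomp Require Import all_classical all_reals all_analysis.
From mathcomp Require Import ring lra zify.
Import Order.TTheory GRing.Theory Num.Theory.
Import numFieldNormedType.Exports.

(** Some integers [m] are sums of two positive cubes in so many ways that the
    perturbation of [n^3] into [a n] cannot spread these representations thinly.

    The duplication formulas of the curve [X^3 + Y^3 = m] (the classical proof,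
    going back to Fermat, that the number of representations as a sum of two
    cubes is unbounded) turn a sum of two cubes [x^3 + y^3] into a difference
    of two rational cubes ([sum_to_diff]), and that difference back into a sum
    ([diff_to_sum]).  The composite of the two maps ([cube_sum_step]) has
    degree 16 and divides the ratio [x / y] by a factor between 1 (excluded)
    and 8 as long as [x / y >= 4].  Starting from [x / y = 4 * 8^k], it can
    therefore be applied [k] times; the successive ratios decrease strictly,
    so the points are distinct, and after clearing denominators they give
    [k + 1] representations of one integer [m].  Both entries of every
    representation lie between [N] and [(96 N)^(32^k)], where [N] is arbitrary
    ([many_cube_sums]).  The logarithm of the height thus grows exponentially
    in [k], which is where the double logarithm of the hypothesis comes from:
    [ln (ln p) <= 32 k + O_N(1)] for every entry [p] ([lnln_bounds]).

    Suppose now that [rep_count a] is bounded by [S].  Given [d > 0], choose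
    [N] so that [|a n - n^3| <= d * ln (ln n)] for [n >= N].  If
    [q^3 + p^3 = m] is one of the [k + 1] representations, then [a q + a p]
    lies within [2 d (32 k + O_N(1))] of [m], and by pigeonhole
    ([size_le_rep_count]) the number [k + 1] of pairs is at most
    [S * (4 d (32 k + O_N(1)) + 3)].  For [d = 1 / (256 (S + 1))] the right-hand
    side is at most [k / 2 + O_{N,S}(1)], which is absurd for large [k]. *)

(** * Integers with many representations as a sum of two cubes *)

(** The tangent at [(x, y)] to the cubic [U^3 + V^3 = x^3 + y^3] meets it again
    at [(X / D, - Y / D)].  In the ratio [x / y], the map is nearly a division
    by 2: [X / Y = (x / y) * (x^3 + 2 y^3) / (2 x^3 + y^3)]. *)
Lemma sum_to_diff (x y : nat) : 0 < y -> 4 * y <= x ->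
  exists X Y D : nat, [/\ X ^ 3 = Y ^ 3 + D ^ 3 * (x ^ 3 + y ^ 3) /\ 0 < D,
    y <= Y, 2 * Y <= X, X * y <= x * Y /\ x * Y <= 2 * (X * y) & X <= 3 * x ^ 4].
Proof.
move=> y0 yx.
have cub : y ^ 3 < x ^ 3 by rewrite ltn_exp2r//; lia.
have v0 : 0 < y ^ 3 by rewrite expn_gt0 y0.
exists (x * (x ^ 3 + 2 * y ^ 3)), (y * (2 * x ^ 3 + y ^ 3)), (x ^ 3 - y ^ 3).
have h1 : x * (y * (2 * x ^ 3 + y ^ 3)) <= 2 * (x * (x ^ 3 + 2 * y ^ 3) * y) by nia.
split => //; last 1 first.
- by rewrite (expnS x 3); nia.
- split; last by rewrite subn_gt0.
  rewrite !expnMn; move: cub; move: (x ^ 3) (y ^ 3) => c v cv.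
  have -> : c = v + (c - v) by lia.
  rewrite addKn; move: (c - v) => D; ring.
- by rewrite leq_pmulr //; lia.
- rewrite -(leq_pmul2r y0); move: h1.
  set Y := y * (_ + _); set X := x * (_ + _) => h1.
  have : 4 * y * Y <= x * Y by rewrite leq_mul2r yx orbT.
  lia.
- by split => //; nia.
Qed.

(** The same tangent construction at the point [(X, - Y)] of
    [U^3 + V^3 = X^3 - Y^3].  The third point
    [(X (X^3 - 2 Y^3) / D, Y (2 X^3 - Y^3) / D)] with [D = X^3 + Y^3] has
    positive coordinates since [X >= 2 Y].  The substitution
    [X^3 = 2 Y^3 + t] removes all the subtractions. *)
Lemma diff_to_sum (X Y : nat) : 0 < Y -> 2 * Y <= X ->
  exists x y D : nat, [/\ x ^ 3 + y ^ 3 + D ^ 3 * Y ^ 3 = D ^ 3 * X ^ 3 /\ 0 < D,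
    Y <= y, x * Y < X * y, X * y <= 4 * (x * Y) & x <= X ^ 4].
Proof.
move=> Y0 YX.
have w0 : 0 < Y ^ 3 by rewrite expn_gt0 Y0.
have cub : 8 * Y ^ 3 <= X ^ 3 by rewrite (_ : 8 = 2 ^ 3)// -expnMn leq_exp2r.
pose t := X ^ 3 - 2 * Y ^ 3.
have tE : X ^ 3 = 2 * Y ^ 3 + t by rewrite /t; lia.
have t6 : 6 * Y ^ 3 <= t by lia.
exists (X * t), (Y * (3 * Y ^ 3 + 2 * t)), (3 * Y ^ 3 + t); split.
- split; last lia.
  rewrite !expnMn tE; ring.
- by rewrite leq_pmulr //; lia.
- have XY : 0 < X * Y by rewrite muln_gt0; lia.
  rewrite mulnAC mulnA ltn_pmul2l //; lia.
- rewrite (mulnAC X) (mulnA X) (mulnCA 4) leq_mul2l; apply/orP; right; lia.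
- by rewrite (expnS X 3) leq_mul2l; apply/orP; right; lia.
Qed.

(** The strict decrease of [x / y] keeps the points of a chain distinct; the
    bound by 8 on its rate keeps [4 * y <= x] true for further steps.  The
    factor 3 on both sides of the last bound makes it a pure power, which
    iterates without accumulating constants. *)
Lemma cube_sum_step (x y : nat) : 0 < y -> 4 * y <= x ->
  exists x' y' d : nat, [/\ x' ^ 3 + y' ^ 3 = d ^ 3 * (x ^ 3 + y ^ 3) /\ 0 < d,
    y <= y', x' * y < x * y', x * y' <= 8 * (x' * y) & 3 * x' <= (3 * x) ^ 16].
Proof.
move=> y0 yx.
have [X [Y [D [[XYE D0] yY YX [r1 r2] Xx]]]] := @sum_to_diff x y y0 yx.
have Y0 : 0 < Y by apply: leq_trans yY.
have [x' [y' [E [[xyE E0] Yy r3 r4 xX]]]] := @diff_to_sum X Y Y0 YX.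
have X0 : 0 < X by lia.
have XY0 : 0 < X * Y by rewrite muln_gt0 X0.
exists x', y', (E * D); split.
- split; last by rewrite muln_gt0 E0.
  apply/eqP; rewrite -(eqn_add2r (E ^ 3 * Y ^ 3)) xyE XYE expnMn; apply/eqP; ring.
- exact: leq_trans Yy.
- rewrite -(ltn_pmul2l XY0).
  have h1 : x' * Y * (X * y) <= x' * Y * (x * Y) by rewrite leq_mul2l r1 orbT.
  have xY0 : 0 < x * Y by rewrite muln_gt0 Y0; lia.
  have h2 : x' * Y * (x * Y) < X * y' * (x * Y) by rewrite ltn_pmul2r.
  have -> : X * Y * (x' * y) = x' * Y * (X * y) by ring.
  have -> : X * Y * (x * y') = X * y' * (x * Y) by ring.
  exact: leq_ltn_trans h2.
- rewrite -(leq_pmul2l XY0).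
  have -> : X * Y * (x * y') = x * Y * (X * y') by ring.
  have -> : X * Y * (8 * (x' * y)) = 2 * (X * y) * (4 * (x' * Y)) by ring.
  exact: leq_mul.
- apply: (@leq_trans (3 * (3 * x ^ 4) ^ 4)).
    rewrite leq_mul2l /=; apply: leq_trans xX _; by rewrite leq_exp2r.
  have -> : 3 * (3 * x ^ 4) ^ 4 = 3 ^ 5 * x ^ 16 by rewrite expnMn -expnM; ring.
  by rewrite expnMn leq_mul2r leq_exp2l ?orbT.
Qed.

(** The induction prepends to a chain started at [(x', y')] the point [(x, y)],
    rescaled by the denominators met later (hence the factor [e], which records
    the scale between [m] and the cubes at the start of the chain).  Every pair
    of the chain has ratio at most [x' / y' < x / y], so the new pair is not
    already there.  Pairs are listed smaller entry first, to match
    [rep_pairs]. *)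
Lemma cube_sum_chain (k x y : nat) : 0 < y -> 4 * 8 ^ k * y <= x ->
  exists (m e : nat) (s : seq (nat * nat)),
    [/\ m = e ^ 3 * (x ^ 3 + y ^ 3) /\ 0 < e, m <= (3 * x) ^ (3 * 16 ^ k),
        size s = k.+1, uniq s &
        forall p, p \in s ->
          [/\ p.2 ^ 3 + p.1 ^ 3 = m, y <= p.1 <= p.2 & p.2 * y <= x * p.1]].
Proof.
elim: k x y => [|k IHk] x y y0 yx.
  exists (x ^ 3 + y ^ 3), 1, [:: (y, x)]; split => //.
  - by rewrite exp1n mul1n.
  - rewrite expn0 muln1 expnMn.
    have : y ^ 3 <= x ^ 3 by rewrite leq_exp2r//; lia.
    lia.
  - by move=> p; rewrite inE => /eqP -> /=; split => //; lia.
have k0 : 0 < 8 ^ k by rewrite expn_gt0.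
have yx4 : 4 * y <= x.
  apply: leq_trans yx; rewrite leq_mul2r; apply/orP; right.
  by rewrite expnS; lia.
have yx1 : y <= x by apply: leq_trans yx4; rewrite leq_pmull.
have [x' [y' [d [[E d0] yy' lt_r ge_r x'x]]]] := @cube_sum_step x y y0 yx4.
have y'0 : 0 < y' by apply: leq_trans yy'.
have yx' : 4 * 8 ^ k * y' <= x'.
  have y80 : 0 < 8 * y by rewrite muln_gt0.
  have h1 : 4 * 8 ^ k * y' * (8 * y) <= x' * (8 * y).
    have -> : 4 * 8 ^ k * y' * (8 * y) = 4 * 8 ^ k.+1 * y * y' by rewrite expnS; ring.
    have -> : x' * (8 * y) = 8 * (x' * y) by ring.
    by apply: leq_trans ge_r; rewrite leq_mul2r yx orbT.
  by rewrite leq_pmul2r in h1.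
have [m [e [s [[mE e0] mB ss us sP]]]] := IHk x' y' y'0 yx'.
have de0 : 0 < e * d by rewrite muln_gt0 e0.
(* [m = e^3 (x'^3 + y'^3) = (e d)^3 (x^3 + y^3)] *)
exists m, (e * d), ((e * d * y, e * d * x) :: s); split => //.
- by split => //; rewrite mE E mulnA expnMn.
- apply: leq_trans mB _; rewrite (expnS 16) mulnCA [leqRHS]expnM.
  by rewrite leq_exp2r ?muln_gt0 ?expn_gt0.
- by rewrite /= ss.
- rewrite /= us andbT; apply/negP => /sP[_ _ /=].
  have -> : e * d * x * y' = e * d * (x * y') by ring.
  have -> : x' * (e * d * y) = e * d * (x' * y) by ring.
  by rewrite leq_pmul2l // leqNgt lt_r.
- move=> p; rewrite inE => /predU1P[-> /=|/sP[h1 /andP[h2 h3] h4]].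
    split.
    + by rewrite mE E !expnMn; ring.
    + by rewrite leq_pmull //= leq_mul2l yx1 orbT.
    + by apply/eq_leq; ring.
  split => //; first by rewrite h3 (leq_trans yy').
  rewrite -(leq_pmul2r y'0).
  have -> : p.2 * y * y' = p.2 * y' * y by ring.
  have -> : x * p.1 * y' = x * y' * p.1 by ring.
  apply: (@leq_trans (x' * p.1 * y)); first by rewrite leq_pmul2r.
  have -> : x' * p.1 * y = x' * y * p.1 by ring.
  by rewrite leq_mul2r (ltnW lt_r) orbT.
Qed.

(** The chain started at [x = 4 * 8^k * N], [y = N].  The bound
    [3 x <= (96 N)^k] holds for [k >= 1], and [k * 16^k <= 32^k] absorbs the
    exponent [k] into a clean double exponential. *)
Lemma many_cube_sums (N k : nat) : 0 < N ->
  exists (m : nat) (s : seq (nat * nat)),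
    [/\ size s = k.+1, uniq s &
        forall p, p \in s ->
          [/\ p.1 ^ 3 + p.2 ^ 3 = m, N <= p.1 <= p.2 & p.2 <= (96 * N) ^ (32 ^ k)]].
Proof.
move=> N0.
have [m [e [s [_ mB ss us sP]]]] := @cube_sum_chain k _ N N0 (leqnn _).
exists m, s; split => // p /sP[pm pN _]; split => //; first by rewrite addnC.
rewrite -(@leq_exp2r _ _ 3)//.
apply: (@leq_trans m); first by rewrite -pm leq_addr.
apply: leq_trans mB _; rewrite (mulnC 3 (16 ^ k)) [leqLHS]expnM leq_exp2r //.
(* for [k = 0] the bound reads [12 N <= 96 N] *)
case: k {ss sP} => [|k]; first by rewrite !expn0 !expn1; lia.
have kE : k.+1 <= 2 ^ k.+1 by apply/ltnW/ltn_expl.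
apply: (@leq_trans ((96 * N) ^ (k.+1 * 16 ^ k.+1))); last first.
  by rewrite leq_pexp2l ?muln_gt0 //  (_ : 32 = 2 * 16)// expnMn leq_mul2r kE orbT.
rewrite [leqRHS]expnM leq_exp2r ?expn_gt0 //.
have -> : 3 * (4 * 8 ^ k.+1 * N) = 12 * N * 8 ^ k.+1 by ring.
rewrite (_ : 96 * N = 12 * N * 8); last by lia.
rewrite expnMn leq_mul // -[leqLHS]expn1 leq_pexp2l //; lia.
Qed.

Local Open Scope classical_set_scope.
Local Open Scope ring_scope.

(** * Representation counts *)

(** Pigeonhole: the pairs of [s] are distributed over the [W + 1] values
    [L, ..., L + W], each of which receives at most [S] of them. *)
Lemma size_le_rep_count (a : nat -> nat) (S L W : nat) (s : seq (nat * nat)) :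
  strictly_incr a -> (forall n, rep_count a n <= S)%N -> uniq s ->
  (forall p, p \in s -> 1 <= p.1 <= p.2 /\ L <= a p.1 + a p.2 <= L + W)%N ->
  (size s <= W.+1 * S)%N.
Proof.
move=> a_incr aS us sP.
have -> : size s = (\sum_(i < W.+1) count (fun p => a p.1 + a p.2 == L + i)%N s)%N.
  under eq_bigr do rewrite -sum1_count big_mkcond /=.
  rewrite exchange_big /= -sum1_size; apply: eq_big_seq => p /sP[_ /andP[Lp pW]].
  have hi : (a p.1 + a p.2 - L < W.+1)%N by lia.
  rewrite (bigD1 (Ordinal hi)) //= subnKC // eqxx big1 // => i /eqP ne.
  case: eqP => // E; case: ne; apply: val_inj => /=; lia.
have -> : (W.+1 * S = \sum_(i < W.+1) S)%N by rewrite sum_nat_const card_ord.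
apply: leq_sum => i _; apply: leq_trans (aS (L + i)%N).
rewrite -size_filter; apply: uniq_leq_size; first exact: filter_uniq.
move=> p; rewrite mem_filter => /andP[/eqP E /sP[h _]].
by rewrite in_fset_set ?inE; [split | exact: finite_rep_pairs].
Qed.

Lemma sup_rep_unbounded (R : realType) (a : nat -> nat) :
  (forall S : nat, exists n, S < rep_count a n)%N -> sup_rep R a = +oo%E.
Proof.
move=> unb; apply/eqyP => A _.
have homo : {homo (fun x : nat => ((max_rep a x)%:R)%:E : \bar R) :
    n m / (n <= m)%N >-> (n <= m)%E}.
  move=> x y xy; rewrite lee_fin ler_nat; apply/bigmax_leqP => i _.
  exact: (@leq_bigmax _ (fun i : 'I_y.+1 => rep_count a i)
    (widen_ord (xy : (x < y.+1)%N) i)).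
rewrite /sup_rep (cvg_lim _ (ereal_nondecreasing_cvgn homo))//.
have [n ltn] := unb (Num.truncn A).
apply: (@le_trans _ _ ((max_rep a n)%:R)%:E); last first.
  by apply: ereal_sup_ubound; exists n.
rewrite lee_fin; apply: ltW; apply: lt_le_trans (truncnS_gt A) _.
rewrite ler_nat; apply: leq_trans ltn _.
exact: (@leq_bigmax _ (fun i : 'I_n.+1 => rep_count a i) ord_max).
Qed.

(** * The double logarithm of the entries *)

Lemma ln_nat_ge1 (R : realType) (n : nat) : (4 <= n)%N -> 1 <= ln (n%:R : R).
Proof.
move=> n4; apply: (@le_trans _ _ (ln 4)); last first.
  by rewrite ler_ln ?posrE ?ler_nat //; rewrite ltr0n; lia.
(* [ln (1 - 1/2) <= - 1/2], that is [1/2 <= ln 2] *)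
have -> : (4 : R) = (1 + - 2^-1)^-1 ^+ 2 by field.
have h : (0 : R) < 1 + - 2^-1 by lra.
rewrite lnXn ?invr_gt0 // lnV ?posrE //.
have := @le_ln1Dx R (- 2^-1) ltac:(lra); lra.
Qed.

(** The lower bound makes [|ln (ln p)|] equal to [ln (ln p)]; the crude estimate
    [ln 32 <= 32] gives the coefficient of [k]. *)
Lemma lnln_bounds (R : realType) (N k p : nat) :
  (4 <= N <= p)%N -> (p <= (96 * N) ^ (32 ^ k))%N ->
  0 <= ln (ln (p%:R : R)) <= 32 * k%:R + ln (ln (96 * N)%:R).
Proof.
move=> /andP[N4 Np] pB.
have p1 := @ln_nat_ge1 R p (leq_trans N4 Np).
have B1 : 1 <= ln ((96 * N)%:R : R) by apply: ln_nat_ge1; lia.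
have B0 : 0 < ((96 * N)%:R : R) by rewrite ltr0n; lia.
rewrite ln_ge0 //=.
have lp : ln (p%:R : R) <= 32 ^+ k * ln (96 * N)%:R.
  apply: le_trans (_ : ln (((96 * N) ^ (32 ^ k))%:R) <= _).
    by rewrite ler_ln ?posrE ?ler_nat // ltr0n ?expn_gt0; lia.
  by rewrite natrX lnXn // -[leLHS]mulr_natl natrX.
apply: le_trans (_ : ln (32 ^+ k * ln (96 * N)%:R) <= _).
  by rewrite ler_ln ?posrE // ?mulr_gt0 ?exprn_gt0 //; lra.
rewrite lnM ?posrE ?exprn_gt0 //; last lra.
rewrite lerD2r lnXn // -[leLHS]mulr_natr ler_wpM2r //.
by apply/ltW/ln_sublinear.
Qed.

(** * Perturbed cubes *)

Theorem corollary1 (R : realType) (a : nat -> nat)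
  (a_incr : strictly_incr a)
  (a_asymp : (fun n : nat => (a n)%:R : R) =
     (fun n : nat => n%:R ^+ 3) +o_\oo (fun n : nat => ln (ln (n%:R : R)))) :
  sup_rep R a = +oo%E.
Proof.
apply: sup_rep_unbounded => S; apply: contrapT => /forallNP bnd.
have {bnd} aS n : (rep_count a n <= S)%N by have /negP := bnd n; rewrite -leqNgt.
have S0 : 0 < S.+1%:R :> R by rewrite ltr0n.
pose d : R := (256 * S.+1%:R)^-1.
have d0 : 0 < d by rewrite invr_gt0 mulr_gt0.
have /eqaddoP/(_ d d0) [N0 _ N0P] := a_asymp.
(* the pairs only involve indices [>= N], where the estimate of [a] holds *)
pose N := maxn N0 4.
have N4 : (4 <= N)%N by rewrite leq_maxr.
pose C := ln (ln ((96 * N)%:R : R)).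
have C0 : 0 <= C.
  by have /andP[] := @lnln_bounds R N 0 (96 * N) ltac:(lia) ltac:(by rewrite expn0 expn1).
(* large enough for [k + 1 <= k / 2 + C / 64 + 3 S] to be false *)
pose k := (Num.truncn C + 6 * S.+1)%N.
have [m [s [ss us sP]]] := @many_cube_sums N k ltac:(lia).
pose T := 2 * d * (32 * k%:R + C).
have T0 : 0 <= T by rewrite mulr_ge0 ?mulr_ge0 ?addr_ge0 ?mulr_ge0 // ltW.
pose t := (Num.truncn T).+1.
have near_cube p : (N <= p)%N -> (p <= (96 * N) ^ (32 ^ k))%N ->
    `|(a p)%:R - p%:R ^+ 3| <= d * (32 * k%:R + C).
  move=> Np pB; apply: le_trans (N0P p _) _ => /=; first by lia.
  have /andP[l0 lB] := @lnln_bounds R N k p ltac:(lia) pB.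
  by rewrite ger0_norm // ler_wpM2l // ltW.
(* if [m < t] then [m - t] is 0, and the window still reaches up to [m + t] *)
have count_le : (k.+1 <= (2 * t).+1 * S)%N.
  rewrite -ss; apply: (@size_le_rep_count a S (m - t)%N (2 * t)%N) => //.
  move=> p /sP[pm /andP[Np pp] pB]; split; first lia.
  have := near_cube p.1 Np ltac:(lia).
  have := near_cube p.2 ltac:(lia) pB.
  rewrite !ler_norml => /andP[l2 u2] /andP[l1 u1].
  have mE : (m%:R : R) = p.1%:R ^+ 3 + p.2%:R ^+ 3 by rewrite -pm natrD !natrX.
  have Tt : T < t%:R := truncnS_gt T.
  have h1 : (m <= a p.1 + a p.2 + t)%N.
    rewrite -(ler_nat R) !natrD; rewrite /T in Tt; lra.
  have h2 : (a p.1 + a p.2 <= m + t)%N.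
    rewrite -(ler_nat R) !natrD; rewrite /T in Tt; lra.
  lia.
have tT : t%:R <= T + 1 by rewrite /t -natr1 lerD2r truncn_le.
have CT : C < (Num.truncn C).+1%:R := truncnS_gt C.
have dE : d * 256 * S.+1%:R = 1.
  by rewrite /d -mulrA mulVf // mulf_neq0 // lt0r_neq0.
have SE : S.+1%:R = S%:R + 1 :> R by rewrite natr1.
have S_ge0 : 0 <= S%:R :> R by [].
have kE : k%:R = (Num.truncn C)%:R + 6 * S.+1%:R :> R by rewrite (natrD R (Num.truncn C)) (natrM R 6).
have {}count_le : k%:R + 1 <= (2 * t%:R + 1) * S%:R :> R.
  by rewrite natr1 -natrM natr1 -natrM ler_nat.
have dS : d * S%:R <= 256^-1.
  have : d * 256 * S%:R <= d * 256 * S.+1%:R by rewrite ler_wpM2l ?ler_nat // mulr_ge0 // ltW.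
  rewrite dE; lra.
have TS : T * S%:R <= (32 * k%:R + C) / 128.
  have : (32 * k%:R + C) * (d * S%:R) <= (32 * k%:R + C) * 256^-1.
    by rewrite ler_wpM2l // addr_ge0 // mulr_ge0.
  rewrite /T; lra.
have tS : t%:R * S%:R <= T * S%:R + S%:R by rewrite -[X in _ + X]mul1r -mulrDl ler_wpM2r.
rewrite -natr1 in CT.
clear a_asymp N0P near_cube; lra.
Qed.
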